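(* Every almost mixed Moore graph is totally regular. That is, if $r,z\ge 1$ and $k$ are integers and $G$ is an $(r,z,k;-1)$-graph, then $G$ is totally regular.
   Context: A mixed graph $G$ consists of a finite vertex set $V(G)$, a set $E(G)$ of edges (unordered pairs of distinct vertices; $x\sim y$ means $\{x,y\}\in E(G)$) and a set $A(G)$ of arcs (ordered pairs of distinct vertices; $x\to y$ means $(x,y)\in A(G)$), with at most one edge or arc between any two vertices (so no two vertices are joined by both an edge and an arc, nor by arcs in both directions). The order of $G$ is $|V(G)|$. For a vertex $v$: $U(v)=\{u: u\sim v\}$, $Z^-(v)=\{u:u\to v\}$, $Z^+(v)=\{u:v\to u\}$; $d(v)=|U(v)|$ is the undirected degree, $d^-(v)=|Z^-(v)|$ the directed in-degree, $d^+(v)=|Z^+(v)|$ the directed out-degree. A walk of length $m$ from $u$ to $v$ is a sequence $u=v_0,\dots,v_m=v$ with $v_i\sim v_{i+1}$ or $v_i\to v_{i+1}$ for each $i<m$; a path is a walk with distinct vertices. The distance $d(u,v)$ is the length of a shortest path from $u$ to $v$ ($\infty$ if none), and the diameter of $G$ is the maximum of $d(u,v)$ over all ordered pairs of vertices. $G$ is totally regular if there are integers $r,z$ with $d(v)=r$ and $d^-(v)=d^+(v)=z$ for all $v\in V(G)$. Mixed Moore bound: $M(r,z,k)=A\frac{u_1^{k+1}-1}{u_1-1}+B\frac{u_2^{k+1}-1}{u_2-1}$, where $w=(z+r)^2+2(z-r)+1$, $u_1=\frac{z+r-1-\sqrt w}{2}$, $u_2=\frac{z+r-1+\sqrt w}{2}$,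 $A=\frac{\sqrt w-(z+r+1)}{2\sqrt w}$, $B=\frac{\sqrt w+(z+r+1)}{2\sqrt w}$. An $(r,z,k;-\delta)$-graph is a mixed graph of diameter $k$ with maximum undirected degree $r$, maximum directed out-degree $z$ and order $M(r,z,k)-\delta$. An almost mixed Moore graph is an $(r,z,k;-1)$-graph with $r,z\ge1$. *)

(* Defs.v *)
From HB Require Import structures.
From mathcomp Require Import all_boot all_order all_algebra.

Set Implicit Arguments.
Unset Strict Implicit.
Unset Printing Implicit Defensive.

Import Order.TTheory GRing.Theory Num.Theory.

Local Open Scope ring_scope.

(* The set of unordered pairs E(G) is encoded by a symmetric irreflexive
   relation; [edge_arc] and [arc_asym] say that any two vertices are joined by
   at most one edge or arc. *)
Record mixed_graph (V : finType) := MixedGraph {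
  edge : rel V;
  arc : rel V;
  edge_sym : symmetric edge;
  edge_irr : irreflexive edge;
  arc_irr : irreflexive arc;
  edge_arc : forall x y, edge x y -> ~~ arc x y;
  arc_asym : forall x y, arc x y -> ~~ arc y x
}.

Section MixedGraphs.

Variables (V : finType) (G : mixed_graph V).

Definition udeg (v : V) : nat := #|[set u | edge G u v]|.
Definition indeg (v : V) : nat := #|[set u | arc G u v]|.
Definition outdeg (v : V) : nat := #|[set u | arc G v u]|.

Definition totally_regular : Prop :=
  exists r z : nat,
    forall v : V, [/\ udeg v = r, indeg v = z & outdeg v = z].

Definition step : rel V := [rel x y | edge G x y || arc G x y].

(* A walk v_0, ..., v_m is represented by v_0 and the sequence [:: v_1; ...; v_m],
   whose size is the length m of the walk. *)
Definition is_walk (u v : V) (p : seq V) : bool :=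
  path step u p && (last u p == v).

Definition is_path (u v : V) (p : seq V) : bool :=
  is_walk u v p && uniq (u :: p).

(* d(u, v) = m with m finite; no m satisfies this when d(u, v) is infinite. *)
Definition is_distance (u v : V) (m : nat) : Prop :=
  (exists2 p, is_path u v p & size p = m) /\
  (forall p, is_path u v p -> (m <= size p)%N).

(* The maximum of d(u, v) over all (u, v) is the natural number k; in
   particular all distances are finite. *)
Definition is_diameter (k : nat) : Prop :=
  (forall u v, exists2 m, is_distance u v m & (m <= k)%N) /\
  (exists u v, is_distance u v k).

End MixedGraphs.

Section MooreBound.

Variables (R : rcfType) (r z k : nat).

Let r' : R := r%:R.
Let z' : R := z%:R.

Definition moore_w : R := (z' + r') ^+ 2 + 2 * (z' - r') + 1.
Definition moore_u1 : R := (z' + r' - 1 - Num.sqrt moore_w) / 2.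
Definition moore_u2 : R := (z' + r' - 1 + Num.sqrt moore_w) / 2.
Definition moore_A : R :=
  (Num.sqrt moore_w - (z' + r' + 1)) / (2 * Num.sqrt moore_w).
Definition moore_B : R :=
  (Num.sqrt moore_w + (z' + r' + 1)) / (2 * Num.sqrt moore_w).

(* For r, z >= 1 none of the denominators vanishes: w = (r+z-1)^2 + 4z > 0, and
   u1 = 1 or u2 = 1 would force r + 2z = 2. *)
Definition mixed_moore_bound : R :=
  moore_A * ((moore_u1 ^+ k.+1 - 1) / (moore_u1 - 1)) +
  moore_B * ((moore_u2 ^+ k.+1 - 1) / (moore_u2 - 1)).

End MooreBound.

(* G is an (r,z,k;-delta)-graph; the Moore bound is evaluated in R. *)
Definition is_moore_defect_graph (R : rcfType) (r z k delta : nat)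
    (V : finType) (G : mixed_graph V) : Prop :=
  [/\ is_diameter G k,
      (\max_(v : V) udeg G v)%N = r,
      (\max_(v : V) outdeg G v)%N = z
    & #|V|%:R = mixed_moore_bound R r z k - delta%:R].

Definition almost_mixed_moore (R : rcfType) (r z k : nat)
    (V : finType) (G : mixed_graph V) : Prop :=
  [/\ (1 <= r)%N, (1 <= z)%N & is_moore_defect_graph R r z k 1 G].

(* Main.v *)
(* A walk is non-backtracking when it never uses an edge twice in a row. Since
   almost mixed Moore graphs are out-regular (r, z) and k >= 2, a vertex u has
   exactly M = |V| + 1 non-backtracking walks of length at most k, so these reach
   every vertex once, except one vertex rho(u) reached twice. Counting the walks
   of length at most k + 1 from u to v by their first and by their last step gives
     z + #{x : u steps to x, rho(x) = v} + ED(u, v)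
       = indeg(v) + [rho(u) steps to v] + DE(u, v),
   where ED (resp. DE) counts walks of length at most k - 1 that start with an
   edge and end with an arc (resp. start with an arc and end with an edge).
   Suppose that indeg(v) < z for some v. Then v is no value of rho and
   ED(u, v) = 0 for all u.
   - If k >= 3, an arc x -> v and an edge y ~ x would give ED(y, v) > 0, so v
     receives no arc and z = 1. Such vertices v are then all adjacent to one
     vertex, every other vertex is a value of rho, and at least half of the
     vertices u satisfy rho(u) ~ v; hence |V| <= 4r, which is too small.
   - If k = 2, every value of rho steps exactly to the vertices of in-degree less
     than z. This forces r = 2 and leaves only two values of rho; the adjacency
     matrix A then satisfies A^2 + A - I = J + R with R of rank 2, and the trace
     of A - 2I modulo 5 is contradictory. *)

Require Import Defs.
From HB Require Import structures.
From mathcomp Require Import all_boot all_order all_algebra.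
From mathcomp Require Import zify ring lra.

Set Implicit Arguments.
Unset Strict Implicit.
Unset Printing Implicit Defensive.

Import Order.TTheory GRing.Theory Num.Theory.
(* [path.arc] would otherwise hide the [arc] of mixed graphs. *)
Import Defs.

(** * Non-backtracking walks *)

Section Walks.

Variables (V : finType) (G : mixed_graph V).
Implicit Types (s t : rel V) (a b : V * V) (F : V * V -> nat) (u v x y : V).

Lemma step_rev u x : step G u x -> step G x u = edge G u x.
Proof.
rewrite /step /= (edge_sym G x u) => /orP[-> // | ux].
have /negbTE-> : ~~ arc G x u by apply: arc_asym ux.
by rewrite orbF.
Qed.

Lemma edge_step u x : edge G u x -> step G u x.
Proof. by rewrite /step /= => ->. Qed.

Lemma edge_stepF u x : ~~ step G u x -> edge G u x = false.
Proof. exact: contraNF (@edge_step u x). Qed.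

Lemma arc_step u x : arc G u x -> step G u x.
Proof. by rewrite /step /= => ->; rewrite orbT. Qed.

Lemma edge_arcF u x : edge G u x && arc G u x = false.
Proof. by apply/negP => /andP[/edge_arc/negP]. Qed.

Lemma step_irr u : step G u u = false.
Proof. by rewrite /step /= edge_irr arc_irr. Qed.

Lemma step_add u x : (step G u x : nat) = edge G u x + arc G u x.
Proof. by rewrite /step /=; move: (edge_arcF u x); do 2?case: (_ G u x). Qed.

Lemma sum_step (f : V -> nat) u :
  \sum_x step G u x * f x
  = \sum_x edge G u x * f x + \sum_x arc G u x * f x.
Proof. by rewrite -big_split; apply: eq_bigr => x _; rewrite step_add mulnDl. Qed.

Lemma sum_udeg u : \sum_x edge G u x = udeg G u.
Proof.
rewrite /udeg -sum1_card [RHS]big_mkcond; apply: eq_bigr => x _.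
by rewrite inE edge_sym; case: edge.
Qed.

Lemma sum_outdeg u : \sum_x arc G u x = outdeg G u.
Proof.
rewrite /outdeg -sum1_card [RHS]big_mkcond; apply: eq_bigr => x _.
by rewrite inE; case: arc.
Qed.

Lemma sum_indeg u : \sum_x arc G x u = indeg G u.
Proof.
rewrite /indeg -sum1_card [RHS]big_mkcond; apply: eq_bigr => x _.
by rewrite inE; case: arc.
Qed.

(* A walk is non-backtracking when it has no edge followed by the same edge;
   since arcs have no reverse, this means that [v_i <> v_(i+2)] for all [i]. *)
Definition turn a b : bool :=
  [&& step G a.1 a.2, step G b.1 b.2, a.2 == b.1 & a.1 != b.2].

(** Walks are handled through their steps, since backtracking concerns two consecutive steps;
    [prolong] is the non-backtracking (Hashimoto) operator. *)
Definition prolong F a : nat := \sum_b turn a b * F b.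

Definition tails t i v : V * V -> nat :=
  iter i prolong (fun a => t a.1 a.2 && (a.2 == v)).

(* The number of non-backtracking walks of length [i.+1] from [u] to [v] whose
   first step satisfies [s] and whose last step satisfies [t]. *)
Definition nwalk s t i u v : nat := \sum_x s u x * tails t i v (u, x).

(** The index [i] of [nwalk] stands for length [i.+1], so the lengths covered are 1 to [j]. *)
Definition cwalk s t j u v : nat := \sum_(i < j) nwalk s t i u v.

Definition reach j u v : nat := (u == v) + cwalk (step G) (step G) j u v.

Lemma sum_pair F : \sum_a F a = \sum_x \sum_y F (x, y).
Proof. by rewrite pair_bigA; apply: eq_bigr => -[]. Qed.

Lemma prolongE F u x : step G u x ->
  prolong F (u, x) = \sum_y (step G x y && (y != u)) * F (x, y).
Proof.
move=> ux; rewrite /prolong sum_pair (bigD1 x) //= [X in _ + X]big1 ?addn0 => [|x' x'x].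
  by apply: eq_bigr => y _; rewrite /turn /= ux eqxx eq_sym.
by apply: big1 => y _; rewrite /turn /= (eq_sym x) (negbTE x'x) !andbF.
Qed.

Lemma leq_nwalk s s' t t' i u v :
  subrel s s' -> subrel t t' -> nwalk s t i u v <= nwalk s' t' i u v.
Proof.
move=> ss' tt'; apply: leq_sum => x _; apply: leq_mul.
  by case: (boolP (s u x)) => // /ss' ->.
elim: i (u, x) => [|i IH] a /=.
  by case: (boolP (t a.1 a.2)) => // /tt' ->.
by apply: leq_sum => b _; rewrite leq_mul2l IH orbT.
Qed.

Lemma nwalk_stepl t i u v :
  nwalk (step G) t i u v = nwalk (edge G) t i u v + nwalk (arc G) t i u v.
Proof. exact: sum_step. Qed.

Lemma tails_step i v a :
  tails (step G) i v a = tails (edge G) i v a + tails (arc G) i v a.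
Proof.
elim: i a => [|i IH] a /=.
  by case: (a.2 == v); rewrite ?andbF // !andbT step_add.
by rewrite -big_split; apply: eq_bigr => b _ /=; rewrite -mulnDr -IH.
Qed.

Lemma nwalk_stepr s i u v :
  nwalk s (step G) i u v = nwalk s (edge G) i u v + nwalk s (arc G) i u v.
Proof.
by rewrite -big_split; apply: eq_bigr => x _ /=; rewrite -mulnDr -tails_step.
Qed.

Lemma nwalk0 s t u v : nwalk s t 0 u v = s u v && t u v.
Proof.
rewrite /nwalk (bigD1 v) //= eqxx andbT big1 ?addn0 => [|x /negbTE xv].
  by case: s; case: t.
by rewrite xv andbF muln0.
Qed.

Lemma nwalkS s t i u v : subrel s (step G) ->
  nwalk s t i.+1 u v =
  \sum_x s u x * \sum_y (step G x y && (y != u)) * tails t i v (x, y).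
Proof.
move=> ss; apply: eq_bigr => x _; case: (boolP (s u x)) => // /ss ux.
by rewrite /tails iterS prolongE.
Qed.

(** A step from [u] to [x] put before a walk from [x] creates a backtrack only if that walk first
    returns to [u], which by [step_rev] requires an edge. *)
Lemma nwalk_first_step t i u v :
  \sum_x step G u x * nwalk (step G) t i x v =
  nwalk (step G) t i.+1 u v + \sum_x edge G u x * tails t i v (x, u).
Proof.
rewrite nwalkS // -big_split; apply: eq_bigr => x _.
case: (boolP (step G u x)) => [ux|nux]; last first.
  by rewrite (edge_stepF nux).
rewrite !mul1n /nwalk (bigD1 u) //= (step_rev ux) addnC; congr (_ + _).
rewrite [RHS](bigD1 u) //= eqxx andbF mul0n add0n.
by apply: eq_bigr => y ->; rewrite andbT.
Qed.

(* The walks lost on the left of [nwalk_first_step] are those of the form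
   [u, x, u, ...]. *)
Lemma backtracks t i u v r : udeg G u = r ->
  \sum_x edge G u x * tails t i.+1 v (x, u) + nwalk (edge G) t i u v =
  r * nwalk (step G) t i u v.
Proof.
move=> <-; rewrite -sum_udeg /nwalk.
under eq_bigr => x _.
  have -> : edge G u x * tails t i.+1 v (x, u) =
    \sum_y edge G u x * ((step G u y && (y != x)) * tails t i v (u, y)).
    case: (boolP (edge G u x)) => ux; last by rewrite big1.
    rewrite mul1n /tails iterS prolongE; last by rewrite edge_step // edge_sym.
    by apply: eq_bigr => y _; rewrite mul1n.
  over.
rewrite exchange_big -big_split big_distrr; apply: eq_bigr => y _ /=.
case: (boolP (step G u y)) => [uy|nuy]; last first.
  rewrite (edge_stepF nuy).
  by rewrite big1 ?muln0 // => x _; rewrite muln0.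
rewrite mul1n big_distrl [RHS](bigD1 y) //= [LHS]addnC; congr (_ + _).
rewrite (bigD1 y) //= eqxx mul0n muln0 add0n.
by apply: eq_bigr => x xy; rewrite eq_sym xy mul1n.
Qed.

(** Sum [nwalk_first_step] over the lengths: the shortest backtracking walks give [r * (u == v)],
    the longer ones are evaluated by [backtracks]. *)
Lemma reach_first_step j u v r : udeg G u = r ->
  \sum_x step G u x * reach j.+1 x v + cwalk (edge G) (step G) j u v =
  cwalk (step G) (step G) j.+2 u v + r * (u == v)
  + r * cwalk (step G) (step G) j u v.
Proof.
move=> ur; rewrite /reach.
under eq_bigr => x _ do rewrite mulnDr.
rewrite big_split /= (_ : \sum_x step G u x * (x == v) = step G u v); last first.
  rewrite (bigD1 v) //= eqxx muln1 big1 ?addn0 // => x /negbTE->.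
  exact: muln0.
under eq_bigr => x _ do rewrite /cwalk big_distrr /=.
rewrite exchange_big.
under eq_bigr => i _ do rewrite nwalk_first_step.
rewrite big_split /= [X in _ + (_ + X)]big_ord_recl /=.
have -> : \sum_x edge G u x * tails (step G) 0 v (x, u) = r * (u == v).
  rewrite -ur -sum_udeg big_distrl; apply: eq_bigr => x _ /=.
  case: (boolP (edge G u x)) => // ux.
  by rewrite edge_step // edge_sym.
have -> : cwalk (step G) (step G) j.+2 u v =
  step G u v + \sum_(i < j.+1) nwalk (step G) (step G) i.+1 u v.
  rewrite /cwalk big_ord_recl; congr (_ + _).
  by rewrite nwalk0 andbb.
rewrite -!addnA; do 3 congr (_ + _).
by rewrite /cwalk -big_split big_distrr; apply: eq_bigr => i _; apply: backtracks.
Qed.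

Lemma leq_nwalkS s s' t i x u v : subrel s' (step G) -> subrel s (step G) ->
  s x u -> (forall y, s' u y -> y != x) ->
  nwalk s' t i u v <= nwalk s t i.+1 x v.
Proof.
move=> ss' ss xu ux; rewrite nwalkS // (bigD1 u) //= xu mul1n.
apply: leq_trans (leq_addr _ _); apply: leq_sum => y _.
by case: (boolP (s' u y)) => // uy; rewrite (ss' _ _ uy) ux.
Qed.

Lemma leq_cwalk s t i j u v : i <= j -> cwalk s t i u v <= cwalk s t j u v.
Proof.
by move=> ij; rewrite /cwalk -(subnKC ij) big_split_ord leq_addr.
Qed.

Lemma leq_cwalkS s s' t j x u v : subrel s' (step G) -> subrel s (step G) ->
  s x u -> (forall y, s' u y -> y != x) ->
  cwalk s' t j u v <= cwalk s t j.+1 x v.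
Proof.
move=> ss' ss xu ux; rewrite /cwalk big_ord_recl.
by apply: leq_trans (leq_addl _ _); apply: leq_sum => i _; apply: leq_nwalkS.
Qed.

Lemma cwalk1 s t u v : cwalk s t 1 u v = s u v && t u v.
Proof. by rewrite /cwalk big_ord1 nwalk0. Qed.

Lemma leq_cwalk1 s t j u v : 0 < j -> s u v -> t u v -> 0 < cwalk s t j u v.
Proof.
move=> j0 suv tuv; apply: leq_trans (leq_cwalk s t u v j0).
by rewrite cwalk1 suv tuv.
Qed.

(** An edge followed by an arc never backtracks. *)
Lemma cwalk_edge_arc t j x u v : edge G x u ->
  cwalk (arc G) t j u v <= cwalk (edge G) t j.+1 x v.
Proof.
move=> xu; apply: leq_cwalkS (xu) _ => [y z|y z|y uy].
- exact: arc_step.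
- exact: edge_step.
by apply: contraTneq uy => ->; apply: edge_arc; rewrite edge_sym.
Qed.

Lemma cwalk_arc_edge t j x u v : arc G x u ->
  cwalk (edge G) t j u v <= cwalk (arc G) t j.+1 x v.
Proof.
move=> xu; apply: leq_cwalkS (xu) _ => [y z|y z|y uy].
- exact: edge_step.
- exact: arc_step.
by apply: contraTneq uy => ->; rewrite edge_sym; apply: contraTN xu; apply: edge_arc.
Qed.

Lemma reachE j u v : reach j u v = (u == v)
  + (cwalk (edge G) (edge G) j u v + cwalk (edge G) (arc G) j u v)
  + (cwalk (arc G) (edge G) j u v + cwalk (arc G) (arc G) j u v).
Proof.
rewrite /reach -addnA; congr (_ + _); rewrite /cwalk -!big_split.
by apply: eq_bigr => i _; rewrite nwalk_stepl !nwalk_stepr.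
Qed.

Lemma cwalk_edge2 u v : u != v ->
  \sum_x (edge G u x && edge G x v) <= cwalk (edge G) (edge G) 2 u v.
Proof.
move=> uv; rewrite /cwalk big_ord_recr /=.
apply: leq_trans (leq_addl _ _); rewrite nwalkS; last exact: edge_step.
apply: leq_sum => x _; case: (edge G u x) => //; rewrite mul1n.
case: (boolP (edge G x v)) => // xv.
by rewrite (bigD1 v) //= eqxx eq_sym uv xv edge_step.
Qed.

(** The only two-step walks that backtrack are the [r] closed ones [u, x, u] along an edge. *)
Lemma reach2 u v r : udeg G u = r ->
  reach 2 u v + r * (u == v) =
  (u == v) + step G u v + \sum_x step G u x * step G x v.
Proof.
move=> ur; rewrite /reach -!addnA; congr (_ + _).
rewrite /cwalk big_ord_recr big_ord1 /= nwalk0 andbb -addnA; congr (_ + _).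
rewrite nwalkS //.
have tE x : \sum_y (step G x y && (y != u)) * tails (step G) 0 v (x, y) =
  (v != u) * step G x v.
  rewrite (bigD1 v) //= eqxx andbT big1 ?addn0 => [|y /negbTE->].
    by case: (step G x v); case: (v != u).
  by rewrite andbF muln0.
under eq_bigr => x _ do rewrite tE.
have [<-|uv] := eqVneq u v.
  rewrite muln1 big1 ?add0n => [|x _]; last by rewrite muln0.
  rewrite -ur -sum_udeg; apply: eq_bigr => x _.
  by case: (boolP (step G u x)) => [/step_rev->|/edge_stepF->]; rewrite ?mul1n.
by rewrite muln0 addn0; under eq_bigr => x _ do rewrite mul1n.
Qed.

Lemma tails_path q u x : path (step G) u (x :: q) -> uniq (u :: x :: q) ->
  0 < tails (step G) (size q) (last x q) (u, x).
Proof.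
elim: q u x => [|y q IH] u x /= /andP[ux]; first by rewrite ux eqxx.
move=> /andP[xy yq] /andP[uxyq uniqq].
rewrite prolongE // (bigD1 y) //= xy eq_sym.
have -> /= : u != y by move: uxyq; rewrite !inE !negb_or => /and3P[].
by rewrite mul1n ltn_addr //; apply: IH => //=; rewrite xy.
Qed.

Lemma reach_path p u v k : is_path G u v p -> size p <= k -> 0 < reach k u v.
Proof.
rewrite /is_path /is_walk /reach => /andP[/andP[]]; case: p => [|x q] /=.
  by move=> _ /eqP -> _ _; rewrite eqxx.
move=> /andP[ux xq] /eqP<- uniqq qk; apply: leq_trans (leq_addl _ _).
apply: leq_trans (leq_cwalk _ _ _ _ qk); rewrite /cwalk big_ord_recr /=.
apply: leq_trans (leq_addl _ _); rewrite /nwalk (bigD1 x) //= ux mul1n.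
by rewrite ltn_addr // tails_path //= ux.
Qed.

End Walks.

(** * Reversed walks and counting by the last step *)

Section Reverse.

Variables (V : finType) (G : mixed_graph V).

Definition rev_graph : mixed_graph V :=
  @MixedGraph V (edge G) (fun x y => arc G y x) (@edge_sym V G) (@edge_irr V G)
    (@arc_irr V G)
    (fun x y xy => edge_arc (etrans (esym (edge_sym G x y)) xy))
    (fun x y => @arc_asym V G y x).

Lemma step_rev_graph x y : step rev_graph x y = step G y x.
Proof. by rewrite /step /= edge_sym. Qed.

Definition swap (a : V * V) := (a.2, a.1).

Lemma swapK : involutive swap. Proof. by case. Qed.

Lemma turn_swap a b : turn rev_graph (swap b) (swap a) = turn G a b.
Proof.
rewrite /turn !step_rev_graph /= (eq_sym b.1) (eq_sym b.2).
by rewrite andbCA.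
Qed.

(* [prolong] for the reversed graph is the adjoint of [prolong]. *)
Lemma iter_prolong_adj i (f g : V * V -> nat) :
  \sum_a f a * iter i (prolong G) g a =
  \sum_a g a * iter i (prolong rev_graph) (f \o swap) (swap a).
Proof.
elim: i g => [|i IH] g.
  by apply: eq_bigr => a _ /=; rewrite swapK mulnC.
under eq_bigr => a _ do rewrite iterSr.
rewrite IH /prolong; under eq_bigr => a _ do rewrite big_distrl /=.
rewrite exchange_big; apply: eq_bigr => b _ /=.
rewrite -/prolong /prolong big_distrr (reindex_inj (inv_inj swapK)) /=.
by apply: eq_bigr => a _; rewrite -turn_swap !swapK /= mulnCA mulnA.
Qed.

Lemma nwalk_rev s t i u v :
  nwalk rev_graph s t i u v
  = nwalk G (fun x y => t y x) (fun x y => s y x) i v u.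
Proof.
have nE (H : mixed_graph V) (s' t' : rel V) u' v' : nwalk H s' t' i u' v' =
  \sum_a (s' a.1 a.2 && (a.1 == u')) * tails H t' i v' a.
  rewrite sum_pair (bigD1 u') //= eqxx [X in _ + X]big1 ?addn0 => [|x /negbTE xu].
    by apply: eq_bigr => x _; rewrite andbT.
  by apply: big1 => y _; rewrite xu andbF.
rewrite !nE iter_prolong_adj (reindex_inj (inv_inj swapK)) /=.
by apply: eq_bigr.
Qed.

End Reverse.

Section LastStep.

Variables (V : finType) (G : mixed_graph V).

Lemma reach_rev j u v : reach (rev_graph G) j u v = reach G j v u.
Proof.
rewrite /reach /cwalk eq_sym; congr (_ + _); apply: eq_bigr => i _.
rewrite nwalk_rev; apply/eqP; rewrite eqn_leq.
by apply/andP; split; apply: leq_nwalk => x y; rewrite step_rev_graph.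
Qed.

Lemma reach_last_step j u v r : udeg G v = r ->
  \sum_x step G x v * reach G j.+1 u x + cwalk G (step G) (edge G) j u v =
  cwalk G (step G) (step G) j.+2 u v + r * (u == v)
  + r * cwalk G (step G) (step G) j u v.
Proof.
move=> vr; have := @reach_first_step _ (rev_graph G) j v u r vr.
under eq_bigr => x _ do rewrite reach_rev step_rev_graph.
have cE s t s' t' i : (forall x y, s x y = s' y x) ->
    (forall x y, t x y = t' y x) ->
    cwalk (rev_graph G) s t i v u = cwalk G t' s' i u v.
  move=> ss tt; apply: eq_bigr => n _; rewrite nwalk_rev; apply/eqP.
  by rewrite eqn_leq; apply/andP; split; apply: leq_nwalk => x y; rewrite ?ss ?tt.
have sE x y : step (rev_graph G) x y = step G y x by apply: step_rev_graph.
by rewrite eq_sym !(cE _ _ _ _ _ sE sE) (cE _ _ _ _ _ (@edge_sym _ G) sE).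
Qed.

(** The expansions by first and by last step have the same right-hand side; their edge-to-edge
    corrections cancel and the mixed ones remain. *)
Lemma reach_commute j u v r : udeg G u = r -> udeg G v = r ->
  \sum_x step G u x * reach G j.+1 x v + cwalk G (edge G) (arc G) j u v =
  \sum_x step G x v * reach G j.+1 u x + cwalk G (arc G) (edge G) j u v.
Proof.
move=> ur vr.
have := reach_first_step j v ur; have := reach_last_step j u vr.
have -> : cwalk G (step G) (edge G) j u v =
    cwalk G (edge G) (edge G) j u v + cwalk G (arc G) (edge G) j u v.
  by rewrite -big_split; apply: eq_bigr => i _; rewrite nwalk_stepl.
have -> : cwalk G (edge G) (step G) j u v =
    cwalk G (edge G) (edge G) j u v + cwalk G (edge G) (arc G) j u v.
  by rewrite -big_split; apply: eq_bigr => i _; rewrite nwalk_stepr.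
lia.
Qed.

End LastStep.

(* The numbers of non-backtracking walks of length [j] with a given origin in
   an out-regular graph, without and with one edge forbidden at the origin. *)
Fixpoint moore_level (r z j : nat) : nat * nat :=
  if j is i.+1 then
    let: (g, h) := moore_level r z i in (r * h + z * g, r.-1 * h + z * g)
  else (1, 1).

Definition moore_nat (r z k : nat) : nat :=
  \sum_(i < k.+1) (moore_level r z i).1.

(** * Walk counts under degree bounds *)

Section MooreCount.

Variables (V : finType) (G : mixed_graph V) (r z : nat).

Lemma sum_edge_except u x :
  \sum_y (edge G x y && (y != u)) = udeg G x - edge G u x.
Proof.
rewrite -sum_udeg [in RHS](bigD1 u) //= (edge_sym G x u) addKn.
rewrite (bigD1 u) //= eqxx andbF add0n.
by apply: eq_bigr => y ->; rewrite andbT.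
Qed.

Lemma sum_step_except u x (f : V -> nat) : step G u x ->
  \sum_y (step G x y && (y != u)) * f y =
  \sum_y (edge G x y && (y != u)) * f y + \sum_y arc G x y * f y.
Proof.
move=> ux; rewrite -big_split; apply: eq_bigr => y _ /=.
rewrite -mulnDl; congr (_ * _).
have [->|] := eqVneq y u; last by rewrite !andbT step_add.
rewrite !andbF; case: (boolP (arc G x u)) => // xu.
move: ux; rewrite /step /= => /orP[|/arc_asym]; last by rewrite xu.
by rewrite edge_sym => /edge_arc; rewrite xu.
Qed.

(** Arriving at [x] by an edge forbids that edge as the next step; arriving by an arc forbids
    nothing. *)
Let level u x i :=
  if edge G u x then (moore_level r z i).2 else (moore_level r z i).1.

Lemma sum_tailsS i u x : step G u x ->
  \sum_v tails G (step G) i.+1 v (u, x) =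
  \sum_y (edge G x y && (y != u)) * \sum_v tails G (step G) i v (x, y) +
  \sum_y arc G x y * \sum_v tails G (step G) i v (x, y).
Proof.
move=> ux; rewrite -sum_step_except //.
under eq_bigr => v _ do rewrite /tails iterS prolongE //.
by rewrite exchange_big; apply: eq_bigr => y _; rewrite big_distrr.
Qed.

Lemma sum_tails0 u x : step G u x -> \sum_v tails G (step G) 0 v (u, x) = 1.
Proof.
move=> ux; rewrite (bigD1 x) //= ux eqxx big1 // => y /negbTE.
by rewrite eq_sym => ->.
Qed.

Lemma sum_tails_le i u x : (forall v, udeg G v <= r) ->
  (forall v, outdeg G v <= z) -> step G u x ->
  \sum_v tails G (step G) i v (u, x) <= level u x i.
Proof.
move=> hr hz; rewrite /level; elim: i u x => [|i IH] u x ux.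
  by rewrite sum_tails0 // if_same.
rewrite sum_tailsS //; case E: (moore_level r z i) => [g h] /=.
rewrite E /= in IH.
have le1 : \sum_y (edge G x y && (y != u)) * \sum_v tails G (step G) i v (x, y)
    <= (r - edge G u x) * h.
  apply: (@leq_trans ((udeg G x - edge G u x) * h)); last first.
    by rewrite leq_mul // leq_sub2r.
  rewrite -sum_edge_except big_distrl leq_sum // => y _.
  case: (boolP (edge G x y)) => //= xy; rewrite leq_mul //.
  by have := IH x y (edge_step xy); rewrite xy.
have le2 : \sum_y arc G x y * \sum_v tails G (step G) i v (x, y) <= z * g.
  apply: (@leq_trans (outdeg G x * g)); last by rewrite leq_mul.
  rewrite -sum_outdeg big_distrl leq_sum // => y _.
  case: (boolP (arc G x y)) => //= xy; rewrite leq_mul //.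
  have := IH x y (arc_step xy).
  by case: (boolP (edge G x y)) => // /edge_arc; rewrite xy.
apply: leq_trans (leq_add le1 le2) _.
by case: (edge G u x); rewrite E ?subn1 ?subn0.
Qed.

Lemma sum_tails_eq i u x : (forall v, udeg G v = r) ->
  (forall v, outdeg G v = z) -> step G u x ->
  \sum_v tails G (step G) i v (u, x) = level u x i.
Proof.
move=> hr hz; rewrite /level; elim: i u x => [|i IH] u x ux.
  by rewrite sum_tails0 // if_same.
rewrite sum_tailsS //; case E: (moore_level r z i) => [g h] /=.
rewrite E /= in IH.
have -> : \sum_y (edge G x y && (y != u)) * \sum_v tails G (step G) i v (x, y)
    = (r - edge G u x) * h.
  rewrite -(hr x) -sum_edge_except big_distrl; apply: eq_bigr => y _.
  case: (boolP (edge G x y)) => //= xy.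
  by rewrite (IH x y (edge_step xy)) xy.
have -> : \sum_y arc G x y * \sum_v tails G (step G) i v (x, y) = z * g.
  rewrite -(hz x) -sum_outdeg big_distrl; apply: eq_bigr => y _.
  case: (boolP (arc G x y)) => //= xy; rewrite (IH x y (arc_step xy)).
  by case: (boolP (edge G x y)) => // /edge_arc; rewrite xy.
by case: (edge G u x); rewrite E ?subn1 ?subn0.
Qed.

Lemma sum_reach k u : \sum_v reach G k u v =
  1 + \sum_(i < k) (\sum_x edge G u x * \sum_v tails G (step G) i v (u, x)
    + \sum_x arc G u x * \sum_v tails G (step G) i v (u, x)).
Proof.
rewrite big_split /= (bigD1 u) //= eqxx big1 => [|v /negbTE]; last first.
  by rewrite eq_sym => ->.
rewrite addn0; congr (_ + _); rewrite exchange_big.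
apply: eq_bigr => i _; rewrite exchange_big -sum_step.
by apply: eq_bigr => x _; rewrite big_distrr.
Qed.

Lemma moore_levelS i : (moore_level r z i.+1).1 =
  r * (moore_level r z i).2 + z * (moore_level r z i).1.
Proof. by rewrite /=; case: moore_level. Qed.

Lemma sum_reach_eq k u : (forall v, udeg G v = r) ->
  (forall v, outdeg G v = z) -> \sum_v reach G k u v = moore_nat r z k.
Proof.
move=> hr hz; rewrite sum_reach /moore_nat big_ord_recl; congr (_ + _).
apply: eq_bigr => i _; rewrite lift0 moore_levelS; congr (_ + _).
  rewrite -[X in _ = X * _](hr u) -sum_udeg big_distrl; apply: eq_bigr => x _.
  case: (boolP (edge G u x)) => // ux.
  by rewrite sum_tails_eq ?edge_step // /level ux.
rewrite -[X in _ = X * _](hz u) -sum_outdeg big_distrl; apply: eq_bigr => x _.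
case: (boolP (arc G u x)) => // ux.
rewrite sum_tails_eq ?arc_step // /level.
by case: (boolP (edge G u x)) => // /edge_arc; rewrite ux.
Qed.

Lemma sum_reach_le k u : (forall v, udeg G v <= r) ->
  (forall v, outdeg G v <= z) -> \sum_v reach G k u v <=
  1 + \sum_(i < k) (udeg G u * (moore_level r z i).2
                    + outdeg G u * (moore_level r z i).1).
Proof.
move=> hr hz; rewrite sum_reach leq_add2l leq_sum // => i _.
apply: leq_add.
  rewrite -sum_udeg big_distrl leq_sum // => x _.
  case: (boolP (edge G u x)) => // ux; rewrite leq_mul //.
  by apply: leq_trans (sum_tails_le i hr hz (edge_step ux)) _; rewrite /level ux.
rewrite -sum_outdeg big_distrl leq_sum // => x _.
case: (boolP (arc G u x)) => // ux; rewrite leq_mul //.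
apply: leq_trans (sum_tails_le i hr hz (arc_step ux)) _; rewrite /level.
by case: (boolP (edge G u x)) => // /edge_arc; rewrite ux.
Qed.

Lemma moore_level_gt0 i : 0 < z ->
  0 < (moore_level r z i).1 /\ 0 < (moore_level r z i).2.
Proof.
by move=> z0; elim: i => //= i; case: moore_level => g h /= [g0 h0]; nia.
Qed.

(* A missing edge or arc at [u] loses a vertex at each of the levels
   [1, ..., k]. *)
Lemma sum_reach_deficient k u : 0 < z ->
  (forall v, udeg G v <= r) -> (forall v, outdeg G v <= z) ->
  \sum_v reach G k u v + k * ((udeg G u < r) || (outdeg G u < z))
  <= moore_nat r z k.
Proof.
move=> z0 hr hz; rewrite /moore_nat big_ord_recl.
apply: leq_trans (leq_add (sum_reach_le k u hr hz) (leqnn _)) _.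
rewrite -addnA leq_add2l -[X in X * _]card_ord -sum1_card big_distrl -big_split.
apply: leq_sum => i _; rewrite lift0 moore_levelS /= mul1n.
have [] := moore_level_gt0 i z0; move: (hr u) (hz u).
case: (ltnP (udeg G u) r); case: (ltnP (outdeg G u) z) => /=; nia.
Qed.

End MooreCount.

(** * The Moore bound *)

Section MooreBoundNat.

Local Open Scope ring_scope.

Variables (R : rcfType) (r z : nat).
Hypotheses (r0 : (0 < r)%N) (z0 : (0 < z)%N).

Local Notation w := (moore_w R r z).
Local Notation q := (Num.sqrt w).
Local Notation u1 := (moore_u1 R r z).
Local Notation u2 := (moore_u2 R r z).
Local Notation A := (moore_A R r z).
Local Notation B := (moore_B R r z).

Let r1 : 1 <= r%:R :> R. Proof. by rewrite ler1n. Qed.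
Let z1 : 1 <= z%:R :> R. Proof. by rewrite ler1n. Qed.

Lemma moore_w_gt0 : 0 < w.
Proof.
have -> : w = (r%:R + z%:R - 1) ^+ 2 + 4 * z%:R by rewrite /moore_w; ring.
by rewrite ltr_wpDl ?sqr_ge0 // mulr_gt0 ?ltr0n.
Qed.

Let qq : q ^+ 2 = w. Proof. by rewrite sqr_sqrtr // ltW // moore_w_gt0. Qed.
Let q0 : q != 0. Proof. by rewrite gt_eqF // sqrtr_gt0 moore_w_gt0. Qed.

(** This is the characteristic equation of the linear recurrence that defines [moore_level]. *)
Lemma moore_u1_root : u1 ^+ 2 = (r%:R + z%:R - 1) * u1 + z%:R.
Proof.
have -> : u1 ^+ 2 = (z%:R + r%:R - 1) * u1
    + (q ^+ 2 - (z%:R + r%:R - 1) ^+ 2) / 4 by rewrite /moore_u1; field.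
by rewrite qq /moore_w; field.
Qed.

Lemma moore_u2_root : u2 ^+ 2 = (r%:R + z%:R - 1) * u2 + z%:R.
Proof.
have -> : u2 ^+ 2 = (z%:R + r%:R - 1) * u2
    + (q ^+ 2 - (z%:R + r%:R - 1) ^+ 2) / 4 by rewrite /moore_u2; field.
by rewrite qq /moore_w; field.
Qed.

Lemma moore_root_neq1 (u : R) :
  u ^+ 2 = (r%:R + z%:R - 1) * u + z%:R -> u - 1 != 0.
Proof.
move=> hu; apply/eqP => /eqP; rewrite subr_eq0 => /eqP uE.
by move: hu r1 z1; rewrite uE expr1n mulr1; lra.
Qed.

(** Writing the levels as [(g, h)], the second identity expresses [r h_j = g_(j+1) - z g_j]; the
    factor [r] avoids a division. *)
Lemma moore_levelE j :
  (moore_level r z j).1%:R = A * u1 ^+ j + B * u2 ^+ j /\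
  r%:R * (moore_level r z j).2%:R
    = (u1 - z%:R) * (A * u1 ^+ j) + (u2 - z%:R) * (B * u2 ^+ j).
Proof.
elim: j => [|j [IHg IHh]].
  rewrite !expr0 /moore_A /moore_B /moore_u1 /moore_u2 /=; split; first by field.
  by field.
rewrite moore_levelS !exprS /=; move: IHg IHh.
case: (moore_level r z j) => g h /=.
set a := A * u1 ^+ j; set b := B * u2 ^+ j => IHg IHh.
have -> : A * (u1 * u1 ^+ j) = u1 * a by rewrite mulrCA.
have -> : B * (u2 * u2 ^+ j) = u2 * b by rewrite mulrCA.
rewrite !natrD !natrM -subn1 natrB //.
split; first by rewrite IHh IHg; ring.
transitivity ((r%:R - 1) * (r%:R * h%:R) + r%:R * z%:R * g%:R : R); first by ring.
rewrite IHh IHg; transitivity ((u1 ^+ 2 - z%:R * u1) * a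
  + (u2 ^+ 2 - z%:R * u2) * b); last by ring.
by rewrite moore_u1_root moore_u2_root; ring.
Qed.

Lemma mixed_moore_boundE k : mixed_moore_bound R r z k = (moore_nat r z k)%:R.
Proof.
rewrite /mixed_moore_bound !subrX1 !(mulrC (_ - 1) (\sum_(_ < _) _)).
rewrite !mulfK ?moore_root_neq1 ?moore_u1_root ?moore_u2_root //.
rewrite /moore_nat natr_sum !big_distrr -big_split.
by apply: eq_bigr => i _ /=; case: (moore_levelE i).
Qed.

End MooreBoundNat.

(** * Traces of matrices *)

Section Trace.

Local Open Scope ring_scope.

Variable F : fieldType.

(** For a rank factorization [N = P Q], square zero forces [Q P = 0], and [P Q] has the same trace
    as [Q P]. *)
Lemma mxtrace_sqr0 n (N : 'M[F]_n) : N *m N = 0 -> \tr N = 0.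
Proof.
move=> NN; have RC : row_base N *m col_base N = 0.
  apply: (row_full_inj (col_base_full N)).
  apply: (row_free_inj (row_base_free N)).
  by rewrite mulmx0 mul0mx mulmxA mulmx_base -mulmxA mulmx_base.
by rewrite -(mulmx_base N) mxtrace_mulC RC mxtrace0.
Qed.

(* The map induced by [N] on the quotient by the image of [C] has square zero,
   hence trace zero. *)
Lemma mxtrace_quotient n m (N : 'M[F]_n) (C : 'M_(n, m)) (L : 'M_(m, n))
    (M : 'M_m) (Y : 'M_(m, n)) :
  L *m C = 1%:M -> N *m C = C *m M -> N *m N = C *m Y -> \tr N = \tr M.
Proof.
move=> LC NC NN; pose N' := N - C *m L *m N.
have N'C : N' *m C = 0.
  by rewrite mulmxBl -!mulmxA NC (mulmxA L) LC mul1mx subrr.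
have N'N : N' *m N = 0.
  by rewrite mulmxBl -!mulmxA NN (mulmxA L) LC mul1mx subrr.
have : N' *m N' = 0.
  by rewrite {2}/N' mulmxBr N'N !mulmxA N'C !mul0mx subr0.
move=> /mxtrace_sqr0; rewrite /N' -mulmxA linearB /= mxtrace_mulC -mulmxA NC.
by rewrite mulmxA LC mul1mx => /subr0_eq.
Qed.

(* In characteristic 5 the polynomial [x^2 + x - 1] is [(x - 2)^2], so that [A - 2]
   has square zero modulo the span of [1] and [chi]. *)
Lemma trace_mod5 (V : finType) (A : V -> V -> F) (chi : V -> F) (y1 y2 : V)
    (c d : F) :
  5%:R = 0 :> F -> chi y1 = 0 -> chi y2 = 1 -> (forall x, A x x = 0) ->
  (forall x, \sum_y A x y = d) -> (forall x, \sum_y A x y * chi y = c) ->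
  (forall x y, \sum_t A x t * A t y + A x y - (x == y)%:R =
    1 + chi x * (y1 == y)%:R + (1 - chi x) * (y2 == y)%:R) ->
  d - 4 + 2 * #|V|%:R = 0.
Proof.
move=> char5 chi1 chi2 A0 Ad Ac AA.
pose e : 'I_#|V| -> V := enum_val.
have sume (g : V -> F) : \sum_i g (e i) = \sum_x g x.
  by rewrite [RHS](reindex e) //; apply: onW_bij; apply: enum_val_bij.
pose D (x y : V) : F := (x == y)%:R.
have sumD x (g : V -> F) : \sum_y D x y * g y = g x.
  rewrite (bigD1 x) //= /D eqxx mul1r big1 ?addr0 // => y /negbTE.
  by rewrite eq_sym => ->; rewrite mul0r.
pose f (x y : V) := A x y - 2 * D x y.
have sumf x (g : V -> F) : \sum_y f x y * g y = \sum_y A x y * g y - 2 * g x.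
  rewrite -(sumD x g) big_distrr -sumrB; apply: eq_bigr => y _ /=.
  by rewrite mulrBl mulrA.
pose N := \matrix_(i, k) f (e i) (e k).
(* The columns of [C] are 1 and [chi]. Evaluation at [y1] and [y2], where [chi] is 0 and 1, gives
   the left inverse [L]; [M] is the action of [A - 2] on the span. *)
pose C := \matrix_(i < #|V|, b < 2) (if b == 0 then 1 else chi (e i)).
pose L := \matrix_(b < 2, i < #|V|)
  (if b == 0 then D y1 (e i) else D y2 (e i) - D y1 (e i)).
pose M : 'M[F]_2 := \matrix_(b, b')
  (if b == 0 then if b' == 0 then d - 2 else c else if b' == 0 then 0 else - 2).
pose Y := \matrix_(b < 2, i < #|V|)
  (if b == 0 then 1 + D y2 (e i) else D y1 (e i) - D y2 (e i)).
have LC : L *m C = 1%:M.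
  apply/matrixP => b b'; rewrite !mxE.
  pose g x : F := if b' == 0 then 1 else chi x.
  transitivity (if b == 0 then g y1 else g y2 - g y1).
    rewrite -(sumD y1 g) -(sumD y2 g) -sumrB -!sume.
    by case: eqP => b0; apply: eq_bigr => i _; rewrite !mxE /g;
      case: eqP => //= _; rewrite ?b0 //= ?mulrBl.
  rewrite /g chi1 chi2 {g}.
  by case: b => [[|[|b]] //= ?]; case: b' => [[|[|b']] //= ?];
    rewrite ?subrr ?subr0.
have NC : N *m C = C *m M.
  apply/matrixP => i b; rewrite !mxE !big_ord_recl big_ord0 !mxE /=.
  pose g x : F := if b == 0 then 1 else chi x.
  transitivity (\sum_y f (e i) y * g y).
    by rewrite -sume; apply: eq_bigr => k _; rewrite !mxE.
  rewrite sumf /g; case: eqP => _.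
    by under eq_bigr => y _ do rewrite mulr1; rewrite Ad; ring.
  by rewrite Ac; ring.
have NN : N *m N = C *m Y.
  apply/matrixP => i k; rewrite !mxE !big_ord_recl big_ord0 !mxE /=.
  transitivity (\sum_t f (e i) t * f t (e k)).
    by rewrite -sume; apply: eq_bigr => t _; rewrite !mxE.
  set x := e i; set y := e k; rewrite sumf.
  have -> : \sum_t A x t * f t y = \sum_t A x t * A t y - 2 * A x y.
    rewrite -(sumD y (A x)) big_distrr -sumrB; apply: eq_bigr => t _ /=.
    by rewrite /f /D (eq_sym t); ring.
  apply: (canRL (subrK _)); apply/eqP; rewrite -subr_eq0; apply/eqP.
  (* This is [(A - 2)^2 = (A^2 + A - 1) + 5 (1 - A)]. *)
  transitivity (\sum_t A x t * A t y + A x y - (x == y)%:R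
    - (1 + chi x * (y1 == y)%:R + (1 - chi x) * (y2 == y)%:R)
    + 5%:R * (D x y - A x y)); first by rewrite /f /D; ring.
  by rewrite AA char5; ring.
have := mxtrace_quotient LC NC NN.
rewrite /mxtrace !big_ord_recl big_ord0.
under eq_bigr => i _ do rewrite mxE /f A0 /D eqxx.
rewrite sumr_const card_ord !mxE /= => E.
transitivity (d - 2 - 2 - (0 - 2 * 1) *+ #|V|); last by rewrite E; ring.
by rewrite -mulr_natr; ring.
Qed.

End Trace.

(** * Vertices of low in-degree *)

Section AlmostMoore.

Variables (V : finType) (G : mixed_graph V) (r z j : nat) (rho : V -> V).
Hypotheses (r_gt0 : 0 < r) (j_gt0 : 0 < j).
Hypotheses (udegE : forall v, udeg G v = r) (outdegE : forall v, outdeg G v = z).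
(* [rho u] is the only vertex reached twice from [u]. *)
Hypothesis reach_rho : forall u v, reach G j.+1 u v = 1 + (v == rho u).

Local Notation EE := (cwalk G (edge G) (edge G)).
Local Notation ED := (cwalk G (edge G) (arc G)).
Local Notation DE := (cwalk G (arc G) (edge G)).

Lemma has_edge u : exists x, edge G u x.
Proof.
apply/existsP; rewrite -[X in is_true X]negbK negb_exists; apply/negP => /forallP nu.
move: r_gt0; rewrite -(udegE u) -sum_udeg big1 // => x _.
by rewrite (negbTE (nu x)).
Qed.

Lemma sum_step_out u : \sum_x step G u x = r + z.
Proof.
rewrite -(udegE u) -(outdegE u) -sum_udeg -sum_outdeg -big_split.
by apply: eq_bigr => x _; rewrite step_add.
Qed.

Lemma sum_step_in v : \sum_x step G x v = r + indeg G v.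
Proof.
rewrite -(udegE v) -sum_udeg -sum_indeg -big_split.
by apply: eq_bigr => x _; rewrite step_add edge_sym.
Qed.

(* Counting the walks of length at most [k + 1] from [u] to [v] by their first
   and by their last step. *)
Lemma balance u v :
  z + \sum_x step G u x * (v == rho x) + ED j u v =
  indeg G v + step G (rho u) v + DE j u v.
Proof.
have := reach_commute j (udegE u) (udegE v).
under eq_bigr => x _ do rewrite reach_rho mulnDr muln1.
under [X in _ = X + _]eq_bigr => x _ do rewrite reach_rho mulnDr muln1.
rewrite !big_split /= sum_step_out sum_step_in.
have -> : \sum_x step G x v * (x == rho u) = step G (rho u) v.
  rewrite (bigD1 (rho u)) //= eqxx muln1 big1 ?addn0 // => x /negbTE->.
  exact: muln0.
lia.
Qed.

(** Walks are split by the kinds of their first and last steps. [EE] keeps length [j.+1], to absorb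
    the walks prolonged in [leq_DE_EE]. *)
Lemma reach_le u v :
  (u == v) + EE j.+1 u v + ED j u v + DE j u v <= 1 + (v == rho u).
Proof.
rewrite -reach_rho reachE.
have := leq_cwalk G (edge G) (arc G) u v (leqnSn j).
have := leq_cwalk G (arc G) (edge G) u v (leqnSn j).
lia.
Qed.

(** The empty walk leaves no room for [DE j v v] unless [rho v = v], and then [rho v] does not step
    to [v]; so these two terms of [balance] add up to at most 1. *)
Lemma indeg_ge v : z <= (indeg G v).+1.
Proof.
have := balance v v; have := reach_le v v; rewrite eqxx.
case: eqP => [<-|_]; first by rewrite step_irr; lia.
by have := leq_b1 (step G (rho v) v); lia.
Qed.

Lemma repeat_count u x v : step G u x -> rho x = v ->
  0 < \sum_x step G u x * (v == rho x).
Proof. by move=> ux <-; rewrite (bigD1 x) //= ux eqxx. Qed.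

Lemma EE_nbr y v : edge G y v -> 0 < EE j y v.
Proof. by move=> yv; apply: leq_cwalk1. Qed.

Lemma leq_EE u v i i' : i <= i' -> EE i u v <= EE i' u v.
Proof. exact: leq_cwalk. Qed.

Lemma leq_DE_EE x u v : edge G x u -> DE j u v <= EE j.+1 x v.
Proof. exact: cwalk_edge_arc. Qed.

Lemma low_nbr_repeat y v : indeg G v < z -> edge G y v -> rho y != v.
Proof.
move=> lowv yv; apply/eqP => ryv.
have := balance y v; rewrite ryv step_irr => b1.
have vy : edge G v y by rewrite edge_sym.
have := leq_DE_EE v vy; have := reach_le v v; rewrite eqxx => b2 b3.
case: (eqVneq v (rho v)) b2 => [rv|_] b2; last lia.
by have := balance v v; rewrite -rv step_irr; lia.
Qed.

(** The edge itself is counted by [EE], which leaves [DE j y v = 0]; the claims follow from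
    [balance]. *)
Lemma low_nbr y v : indeg G v < z -> edge G y v ->
  step G (rho y) v /\ forall x, step G y x -> rho x != v.
Proof.
move=> lowv yv; have ryv := low_nbr_repeat lowv yv.
have := reach_le y v; have := leq_EE y v (leqnSn j); have := EE_nbr yv.
rewrite eq_sym in ryv; rewrite (negbTE ryv) => b1 b2 b3.
have := balance y v; have := leq_b1 (step G (rho y) v) => b4 b5.
split; first by case: (step G (rho y) v) b4 b5 => //; lia.
move=> x yx; apply/eqP => /(repeat_count yx); lia.
Qed.

(** Let [u] be a neighbour of [x]. If [rho x = v], [balance] gives [DE j x v > 0] and
    [step G (rho u) v + DE j u v >= 2]. Prolonging by the edge [ux] makes [EE j.+1 u v] positive,
    which is one walk too many from [u] to [v]. *)
Lemma low_not_repeat v x : indeg G v < z -> rho x != v.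
Proof.
move=> lowv; apply/eqP => rxv.
have [u xu] := has_edge x; have ux : edge G u x by rewrite edge_sym.
have c1 := repeat_count (edge_step ux) rxv.
have := balance u v; have := balance x v; rewrite rxv step_irr => b1 b2.
have := reach_le u v; have := reach_le x v; rewrite rxv eqxx => b3 b4.
have b5 := leq_DE_EE v xu; have b6 := leq_DE_EE v ux.
have [ruv|ruv] := eqVneq v (rho u); last first.
  by rewrite (negbTE ruv) in b4; case: (step G (rho u) v) b2; lia.
by rewrite -ruv step_irr in b2; lia.
Qed.

Lemma low_repeatF v x : indeg G v < z -> (v == rho x) = false.
Proof. by move=> lowv; rewrite eq_sym; apply/negbTE/low_not_repeat. Qed.

(** Here [balance] reads [1 + ED = step G (rho u) v + DE], while [reach_le] bounds [ED + DE] by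
    1. *)
Lemma low_unique u v : indeg G v < z ->
  ED j u v = 0 /\ step G (rho u) v + DE j u v = 1.
Proof.
move=> lowv; have := balance u v; have := reach_le u v.
rewrite (low_repeatF u lowv) big1 => [|x _].
  by have := indeg_ge v; case: (step G (rho u) v); lia.
by rewrite low_repeatF ?muln0.
Qed.

Lemma not_repeat w : (forall x, rho x != w) -> indeg G w <= z /\
  (indeg G w = z -> forall u, DE j u w = 0 /\ (step G (rho u) w : nat) = ED j u w).
Proof.
move=> nw; have s0 u : \sum_x step G u x * (w == rho x) = 0.
  by apply: big1 => x _; rewrite eq_sym (negbTE (nw x)) muln0.
have nw' x : (w == rho x) = false by rewrite eq_sym (negbTE (nw x)).
split=> [|wz u].
  by have := balance w w; have := reach_le w w; rewrite s0 nw' eqxx; lia.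
by have := balance u w; have := reach_le u w; rewrite s0 nw'; lia.
Qed.

(** * Diameter at least 3 *)

Section LargeDiameter.

Hypothesis j_gt1 : 1 < j.

Lemma low_no_arc v x : indeg G v < z -> ~~ arc G x v.
Proof.
move=> lowv; apply/negP => xv.
have [y xy] := has_edge x; have yx : edge G y x by rewrite edge_sym.
have := cwalk_edge_arc (arc G) 1 v yx.
rewrite cwalk1 xv => b1.
have [b2 _] := low_unique y lowv.
have := leq_cwalk G (edge G) (arc G) y v j_gt1; lia.
Qed.

Lemma low_indeg0 v : indeg G v < z -> indeg G v = 0 /\ z = 1.
Proof.
move=> lowv; have v0 : indeg G v = 0.
  by rewrite -sum_indeg big1 // => x _; rewrite (negbTE (low_no_arc x lowv)).
by split => //; have := indeg_ge v; lia.
Qed.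

Lemma low_stepE v x : indeg G v < z -> step G x v = edge G x v.
Proof. by move=> lowv; rewrite /step /= (negbTE (low_no_arc x lowv)) orbF. Qed.

Lemma not_repeat_nbr_low w y : 0 < z -> (forall x, rho x != w) ->
  indeg G w = z -> edge G y w -> indeg G y < z.
Proof.
move=> z0 nw wz yw; rewrite -sum_indeg big1 // => x _; apply/eqP.
rewrite eqb0; apply/negP => xy.
have := cwalk_arc_edge (edge G) 1 w xy; rewrite cwalk1 yw => b1.
have [_ /(_ wz x) [b2 _]] := not_repeat nw.
have := leq_cwalk G (arc G) (edge G) x w j_gt1; lia.
Qed.

Lemma low_edge_repeat v : indeg G v < z -> edge G (rho v) v.
Proof.
move=> lowv; have := reach_le v v; have [_] := low_unique v lowv.
rewrite (low_repeatF v lowv) eqxx low_stepE //.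
by case: (edge G (rho v) v); lia.
Qed.

Lemma low_common_unique v v' x y : indeg G v < z -> v != v' ->
  edge G v x -> edge G v' x -> edge G v y -> edge G v' y -> x = y.
Proof.
move=> lowv vv' vx v'x vy v'y; apply/eqP/negPn/negP => xy.
have v'v : v' != v by rewrite eq_sym.
have := cwalk_edge2 G v'v; rewrite (bigD1 x) //= (bigD1 y) 1?eq_sym //=.
rewrite v'x v'y !(edge_sym G _ v) vx vy /=.
have := reach_le v' v; rewrite (negbTE v'v) (low_repeatF v' lowv).
have : EE 2 v' v <= EE j.+1 v' v by apply: leq_EE; apply: leqW.
lia.
Qed.

(** The common neighbour is [rho v'] if [DE j v' v = 0]. Otherwise it is [rho y] for any neighbour
    [y] of [v']: prolonging from [y] makes [EE] positive, hence [DE j y v = 0]. *)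
Lemma low_common_nbr v v' : indeg G v < z -> indeg G v' < z -> v != v' ->
  exists2 y, edge G v y & edge G v' y.
Proof.
move=> lowv lowv' vv'; have [_] := low_unique v' lowv; rewrite low_stepE //.
have [d0|d0] := posnP (DE j v' v).
  rewrite d0; case: (boolP (edge G (rho v') v)) => // e _.
  exists (rho v'); first by rewrite edge_sym.
  by rewrite edge_sym low_edge_repeat.
move=> _; have [y v'y] := has_edge v'.
have yv' : edge G y v' by rewrite edge_sym.
have := leq_DE_EE v yv'; have := reach_le y v.
rewrite (low_repeatF y lowv) => b1 b2.
have [+ _] := low_nbr lowv' yv'; rewrite low_stepE // => ry'.
have [_] := low_unique y lowv; rewrite low_stepE //.
case: (boolP (edge G (rho y) v)) => [ry _|]; last lia.
by exists (rho y); rewrite edge_sym.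
Qed.

Lemma low_edge_repeat2 v v' : indeg G v < z -> indeg G v' < z -> v != v' ->
  edge G (rho v') v.
Proof.
move=> lowv lowv' vv'; have [y vy v'y] := low_common_nbr lowv lowv' vv'.
have v'v : v' != v by rewrite eq_sym.
have [_] := low_unique v' lowv; rewrite low_stepE //.
have := cwalk_edge2 G v'v; rewrite (bigD1 y) //= v'y (edge_sym G y) vy.
have := reach_le v' v; rewrite (low_repeatF v' lowv).
have : EE 2 v' v <= EE j.+1 v' v by apply: leq_EE; apply: leqW.
by case: edge => //; lia.
Qed.

Lemma low_repeat_edge v v' : indeg G v < z -> indeg G v' < z ->
  edge G (rho v) v'.
Proof.
move=> lowv lowv'; have [->|vv'] := eqVneq v v'; first exact: low_edge_repeat.
by apply: low_edge_repeat2; rewrite // eq_sym.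
Qed.

(** If [w] is no value of [rho], its neighbours are low. Two of them would share both [w] and some
    [rho y], so [w] has a single neighbour [y] and [r = 1]; but [y] is adjacent to both [w] and
    [rho y]. *)
Lemma high_is_repeat v w : 0 < z -> indeg G v < z -> z <= indeg G w ->
  exists x, rho x = w.
Proof.
move=> z0 lowv hw; case: (boolP [exists x, rho x == w]) => [/existsP[x /eqP]|].
  by exists x.
rewrite negb_exists => /forallP nw.
have wz : indeg G w = z by apply/eqP; rewrite eqn_leq hw; have [->] := not_repeat nw.
have Uw y : edge G y w -> indeg G y < z by apply: not_repeat_nbr_low.
have rw y : edge G y w -> forall y', edge G y' w -> y' = y.
  move=> yw y' y'w; apply/eqP/negPn/negP => yy'.
  have := @low_common_unique y' y w (rho y) (Uw _ y'w) yy'.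
  rewrite y'w yw !(edge_sym G _ (rho y)) !low_repeat_edge ?Uw // => /(_ isT isT isT isT).
  by move/esym/eqP; rewrite (negbTE (nw _)).
have [y wy] := has_edge w; have yw : edge G y w by rewrite edge_sym.
have r1 : r = 1.
  rewrite -(udegE w) -sum_udeg (bigD1 y) //= wy big1 // => x xy.
  apply/eqP; rewrite eqb0; apply: contra xy => wx.
  by apply/eqP/(rw _ yw); rewrite edge_sym.
exfalso; move: r1; rewrite -(udegE y) -sum_udeg (bigD1 w) //= yw.
rewrite (bigD1 (rho y)) /=; last exact: nw.
by rewrite (edge_sym G y) low_edge_repeat // Uw.
Qed.

(* With [B] the set of vertices having a walk to [v] counted by [DE], no edge
   joins two vertices of [B], while all vertices but at most [2 * r] belong
   to [rho @: B]. *)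
Lemma low_bound v : 0 < z -> indeg G v < z -> #|V| <= 4 * r.
Proof.
move=> z0 lowv; set B := [set u | 0 < DE j u v].
have BP u : u \in B = ~~ edge G (rho u) v.
  have [_] := low_unique u lowv; rewrite low_stepE // inE.
  by case: edge; lia.
have indepB u x : u \in B -> edge G u x -> x \notin B.
  rewrite !inE => uB ux; have xu : edge G x u by rewrite edge_sym.
  have := leq_DE_EE v xu; have := reach_le x v.
  by rewrite (low_repeatF x lowv); lia.
(* Every edge at [B] leaves [B], and all undirected degrees equal [r]. *)
have leB : #|B| <= #|~: B|.
  rewrite -(leq_pmul2r r_gt0).
  have deg (A : {set V}) : #|A| * r = \sum_(u in A) \sum_x edge G u x.
    by rewrite -sum_nat_const; apply: eq_bigr => u _; rewrite sum_udeg udegE.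
  rewrite !deg [X in _ <= X]exchange_big /=.
  rewrite [X in _ <= X](bigID (fun u => u \in B)) /= -[X in X <= _]addn0 leq_add //.
  apply: leq_sum => u uB; rewrite [X in _ <= X]big_mkcond leq_sum // => x _.
  rewrite inE (edge_sym G x).
  by case: (boolP (edge G u x)) => // /(indepB _ _ uB) ->.
pose S := [set u | indeg G u < z].
have subS : S \subset [set x | edge G x (rho v)].
  by apply/subsetP => x; rewrite !inE edge_sym => lx; apply: low_repeat_edge.
have leS : #|S| <= r.
  by rewrite -(udegE (rho v)); apply: subset_leq_card.
have subB : ~: (S :|: [set x | edge G x v]) \subset rho @: B.
  apply/subsetP => w; rewrite !inE negb_or -leqNgt => /andP[wS wv].
  have [x xw] := high_is_repeat z0 lowv wS; apply/imsetP; exists x => //.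
  by rewrite BP xw.
have := leq_trans (subset_leq_card subB) (leq_imset_card _ _).
have : #|S :|: [set x | edge G x v]| <= #|S| + r.
  by rewrite -(udegE v) cardsU leq_subr.
have := cardsC (S :|: [set x | edge G x v]); have := cardsC B.
lia.
Qed.

End LargeDiameter.

(** * Diameter 2 *)

Section DiameterTwo.

Hypothesis j1 : j = 1.
Hypothesis card_V : #|V| = (r + z) ^ 2 + z.

Lemma balance2 u v :
  z + \sum_x step G u x * (v == rho x) = indeg G v + step G (rho u) v.
Proof.
have := balance u v; rewrite j1 !cwalk1 edge_arcF andbC edge_arcF; lia.
Qed.

Lemma low_step_repeat u v : indeg G v < z -> step G (rho u) v.
Proof.
move=> /(low_unique u)[_]; rewrite j1 cwalk1 andbC edge_arcF.
by case: step.
Qed.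

Lemma reach2_rho u v : 1 + (v == rho u) + r * (u == v) =
  (u == v) + step G u v + \sum_x step G u x * step G x v.
Proof. by rewrite -reach_rho j1; apply: reach2. Qed.

(* The walks of length at most [2] ending at [v] number exactly [#|V|], which
   forces an excess of arcs into the in-neighbours of [v]. *)
Lemma card_low v : indeg G v < z -> r + z <= #|[set x | indeg G x < z]|.
Proof.
move=> lowv.
have in_walks : \sum_x step G x v * (r + indeg G x) = (r + z) ^ 2.
  have : \sum_u (1 + (v == rho u) + r * (u == v)) =
      \sum_u ((u == v) + step G u v + \sum_x step G u x * step G x v).
    by apply: eq_bigr => u _; apply: reach2_rho.
  under eq_bigr => u _ do rewrite low_repeatF // addn0.
  rewrite !big_split /= sum1_card card_V -big_distrr /= exchange_big sum_step_in.
  have -> : \sum_u (u == v) = 1.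
    by rewrite (bigD1 v) //= eqxx big1 // => u /negbTE->.
  under eq_bigr => x _ do rewrite -big_distrl /= sum_step_in mulnC.
  by rewrite /= => E; have := indeg_ge v; lia.
have le_in : \sum_x step G x v * (r + indeg G x) <=
    (r + indeg G v) * (r + z) + \sum_x (indeg G x - z).
  rewrite -sum_step_in big_distrl -big_split leq_sum // => x _ /=.
  by case: (step G x v); lia.
have sumz : \sum_x indeg G x = \sum_(x : V) z.
  under eq_bigr => x _ do rewrite -sum_indeg.
  by rewrite exchange_big; apply: eq_bigr => x _; rewrite sum_outdeg.
have excess : \sum_x (indeg G x - z) = \sum_x (z - indeg G x).
  have : \sum_x (indeg G x - z) + \sum_(x : V) z =
      \sum_x (z - indeg G x) + \sum_x indeg G x.
    by rewrite -!big_split; apply: eq_bigr => x _ /=; lia.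
  by rewrite sumz => /addIn.
have : \sum_x (z - indeg G x) = #|[set x | indeg G x < z]|.
  rewrite -sum1_card [RHS]big_mkcond; apply: eq_bigr => x _; rewrite inE.
  by case: ltnP; have := indeg_ge x; lia.
(* Since [indeg G v = z - 1], the count [(r + z)^2] is at most [(r + z - 1) (r + z)] plus the number
   of low vertices. *)
by have := indeg_ge v; nia.
Qed.

Section LowVertex.

Variable v0 : V.
Hypothesis low_v0 : indeg G v0 < z.

Lemma step_repeatE u x : step G (rho u) x = (indeg G x < z).
Proof.
have subS : [set x | indeg G x < z] \subset [set x | step G (rho u) x].
  by apply/subsetP => y; rewrite !inE; apply: low_step_repeat.
have : [set x | indeg G x < z] == [set x | step G (rho u) x].
  rewrite eqEcard subS; apply: leq_trans (card_low low_v0).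
  rewrite -(sum_step_out (rho u)) -sum1_card big_mkcond leq_sum // => y _.
  by rewrite inE; case: step.
by move=> /eqP/setP/(_ x); rewrite !inE.
Qed.

(** A two-step walk from [rho u] to [rho u'] passes through a low vertex, to which [rho u'] also
    steps; so its second step is one of the [r] edges at [rho u']. *)
Lemma repeat_pair u u' :
  1 + (rho u' == rho (rho u)) + r * (rho u == rho u') = (rho u == rho u') + r.
Proof.
rewrite reach2_rho step_repeatE (negbTE (_ : ~~ (indeg G (rho u') < z))); last first.
  by apply/negP => /(low_not_repeat u'); rewrite eqxx.
rewrite addn0 -(udegE (rho u')) -sum_udeg; congr (_ + _); apply: eq_bigr => x _.
rewrite step_repeatE -(step_repeatE u').
by case: (boolP (step G (rho u') x)) => [/step_rev->|/edge_stepF->]; rewrite ?mul1n.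
Qed.

Lemma two_repeats : r = 2 /\ exists y1 y2,
  [/\ rho y1 = y2, rho y2 = y1, y1 != y2 & forall u, rho u = y1 \/ rho u = y2].
Proof.
pose y1 := rho v0; pose y2 := rho y1.
have irr u : rho (rho u) != rho u.
  by apply/negP => ruu; have := repeat_pair u u; rewrite eqxx eq_sym ruu; lia.
have y12 : (y1 == y2) = false by rewrite eq_sym; apply/negbTE/irr.
have r2 : r = 2.
  by have := repeat_pair v0 y1; rewrite -/y1 -/y2 y12 eqxx; lia.
have or12 u : rho u = y1 \/ rho u = y2.
  have [|uy] := eqVneq (rho u) y1; [by left | right; apply/eqP].
  have := repeat_pair v0 u; rewrite -/y1 -/y2 (eq_sym y1) (negbTE uy) r2.
  by case: eqP.
split=> //; exists y1, y2; split; rewrite ?y12 //.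
by have [//|/eqP] := or12 y2; rewrite (negbTE (irr y1)).
Qed.

(** The value is independent of [u]: the adjacency matrix sends the indicator of a fibre of [rho] to
    a constant vector, as [trace_mod5] requires. *)
Lemma sum_step_repeat u y :
  \sum_x step G u x * (rho y == rho x) = indeg G (rho y) - z.
Proof.
have := balance2 u (rho y); rewrite step_repeatE.
case: (boolP (indeg G (rho y) < z)) => [/(low_not_repeat y)|]; first by rewrite eqxx.
lia.
Qed.

End LowVertex.

Lemma diameter_two v : z <= indeg G v.
Proof.
rewrite leqNgt; apply/negP => lowv.
have [r2 [y1 [y2 [ry1 ry2 y12 or12]]]] := two_repeats lowv.
pose A x y : 'F_5 := (step G x y)%:R%R.
pose chi x : 'F_5 := (rho x == y1)%:R%R.
have char5 : 5%:R%R = 0%R :> 'F_5 by apply: pchar_Fp_0.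
have : ((r + z)%:R - 4 + 2 * #|V|%:R = 0 :> 'F_5)%R.
  apply: (@trace_mod5 _ _ A chi y1 y2 (indeg G y1 - z)%:R%R) => // [||x|x|x|x y].
  - by rewrite /chi ry1 eq_sym (negbTE y12).
  - by rewrite /chi ry2 eqxx.
  - by rewrite /A step_irr.
  - by rewrite -natr_sum sum_step_out.
  - rewrite -{1}ry2 -(sum_step_repeat lowv x y2) natr_sum.
    by apply: eq_bigr => y _; rewrite natrM /chi ry2 (eq_sym y1).
  have : (1 + (y == rho x) + 2 * (x == y))%N%:R%R =
      ((x == y) + step G x y + \sum_t step G x t * step G t y)%N%:R%R :> 'F_5.
    by congr (_%:R)%R; rewrite -reach2_rho r2.
  rewrite mul2n -addnn !natrD natr_sum.
  under eq_bigr => t _ do rewrite natrM -/(A x t) -/(A t y).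
  rewrite -/(A x y) => E.
  transitivity (1 + (y == rho x)%:R : 'F_5)%R.
    apply: (addIr ((x == y)%:R + (x == y)%:R)%R); rewrite E; ring.
  have [rx|rx] := or12 x; rewrite rx (eq_sym y).
    have -> : chi x = 1%R by rewrite /chi rx eqxx.
    by ring.
  have -> : chi x = 0%R by rewrite /chi rx eq_sym (negbTE y12).
  by ring.
(* With [n = r + z] and [r = 2], [#|V| = n^2 + n - 2]. The trace condition becomes
   [2 n^2 + 3 n + 2 = 0] modulo 5, whose discriminant is not a square. *)
have -> : ((r + z)%:R - 4 + 2 * #|V|%:R = (2 * (r + z) ^ 2 + 3 * (r + z) + 2)%N%:R
    - 5%:R * 2 :> 'F_5)%R.
  have cardE : (#|V|%:R + 2 = (r + z)%:R ^+ 2 + (r + z)%:R :> 'F_5)%R.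
    by rewrite -natrX -!natrD card_V [in RHS]r2; congr (_%:R)%R; lia.
  transitivity (2 * (#|V|%:R + 2) + (r + z)%:R - 8 : 'F_5)%R; first by ring.
  by rewrite cardE; ring.
rewrite char5 mul0r subr0 => /eqP; rewrite -(dvdn_pcharf (pchar_Fp _)) //.
rewrite {1 2}(divn_eq (r + z) 5); move: ((r + z) %/ 5) (ltn_pmod (r + z) (isT : 0 < 5)).
move=> a; case: ((r + z) %% 5) => [|[|[|[|[|//]]]]] _; lia.
Qed.

End DiameterTwo.
End AlmostMoore.

(** * Total regularity *)

Lemma sum_nat_succ (V : finType) (f : V -> nat) : (forall v, 0 < f v) ->
  \sum_v f v = #|V| + 1 -> exists y, forall v, f v = 1 + (v == y).
Proof.
move=> f0 sumf; have : \sum_v (f v - 1) = 1.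
  apply/(@addIn (\sum_(v : V) 1)); rewrite -big_split sum1_card addnC -sumf.
  by apply: eq_bigr => v _ /=; rewrite subnK.
move=> /eqP/sum_nat_eq1[y [_ fy fv]]; exists y => v.
by have := f0 v; have [->|/fv/(_ isT)] := eqVneq v y; lia.
Qed.

Theorem theorem3p10 (R : rcfType) (r z k : nat) (V : finType)
    (G : mixed_graph V) :
  almost_mixed_moore R r z k G -> totally_regular G.
Proof.
case=> r0 z0 [[dist _] maxr maxz cardV].
have {}cardV : moore_nat r z k = #|V| + 1.
  apply/eqP; rewrite -(eqr_nat R) natrD cardV mixed_moore_boundE //.
  by rewrite subrK.
have hr v : udeg G v <= r by rewrite -maxr leq_bigmax.
have hz v : outdeg G v <= z by rewrite -maxz leq_bigmax.
have reach0 u v : 0 < reach G k u v.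
  have [m [[p pP pm] _] mk] := dist u v.
  by apply: reach_path pP _; rewrite pm.
(* The head of an arc has no step back to its tail, so their distance is at least 2. *)
have k1 : 1 < k.
  rewrite ltnNge; apply/negP => lek.
  have [v /existsP[x vx]] : exists v, [exists x, arc G v x].
    apply/existsP; rewrite -[X in is_true X]negbK negb_exists; apply/negP.
    move=> /forallP noarc; move: z0; rewrite -maxz big1 // => v _.
    rewrite -sum_outdeg big1 // => x _; apply/eqP; rewrite eqb0.
    by move: (noarc v); rewrite negb_exists => /forallP.
  have := reach0 x v; rewrite /reach; case: eqP => [xv|_ /=].
    by move: vx; rewrite xv arc_irr.
  have := leq_cwalk G (step G) (step G) x v lek.
  rewrite cwalk1 andbb /step /= edge_sym (negbTE (arc_asym vx)) orbF.
  by case: (boolP (edge G v x)) => [/edge_arc|_]; [rewrite vx | lia].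
have sum_ge u : #|V| <= \sum_v reach G k u v.
  by rewrite -sum1_card leq_sum.
(* A deficient vertex would lose [k >= 2] walks, but only one is spare. *)
have outreg u : udeg G u = r /\ outdeg G u = z.
  have := sum_reach_deficient k u z0 hr hz; have := sum_ge u.
  rewrite cardV; have := hr u; have := hz u.
  case: (ltnP (udeg G u) r); case: (ltnP (outdeg G u) z) => /=; lia.
have udegE v : udeg G v = r by have [] := outreg v.
have outdegE v : outdeg G v = z by have [] := outreg v.
have [rho rhoE] : exists rho : V -> V, forall u v, reach G k u v = 1 + (v == rho u).
  apply: (@fin_all_exists V (fun=> V)
    (fun u y => forall v, reach G k u v = 1 + (v == y))) => u.
  apply: sum_nat_succ; first exact: reach0.
  by rewrite (sum_reach_eq k u udegE outdegE).
have indeg_high v : z <= indeg G v.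
  case: k k1 rhoE cardV {maxr maxz} dist reach0 sum_ge
    => [//|[//|[|j]]] _ rhoE cardV _ _ _.
    apply: (diameter_two r0 _ udegE outdegE rhoE) => //.
    move: cardV; rewrite /moore_nat !big_ord_recl big_ord0 /= !muln1 /=.
    by nia.
  rewrite leqNgt; apply/negP => lowv.
  have := low_bound r0 (ltn0Sn _) udegE outdegE rhoE isT z0 lowv.
  have [_ z1] := low_indeg0 r0 (ltn0Sn _) udegE outdegE rhoE isT lowv.
  (* Levels 0 to 2 alone give [#|V| >= r^2 + 2 r + 2 > 4 r]. *)
  move: cardV; rewrite z1 /moore_nat 3!big_ord_recl /= !muln1 !mul1n.
  set s := \sum_(i < _) _; case: (r) r0 => // r' _ /=; nia.
exists r, z => v; split=> //.
(* The in-degrees are at least [z] and average to [z]. *)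
have sumz : \sum_x indeg G x = \sum_(x : V) z.
  under eq_bigr => x _ do rewrite -sum_indeg.
  by rewrite exchange_big; apply: eq_bigr => x _; rewrite sum_outdeg.
apply/eqP; rewrite eqn_leq indeg_high andbT.
rewrite -(leq_add2r (\sum_(x | x != v) z)).
move: sumz; rewrite (bigD1 v) //= [in RHS](bigD1 v) //= => <-.
by rewrite leq_add2l leq_sum.
Qed.
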